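(* Let $p$ be an odd prime, $m\geq 1$ an integer, $p-1=ef$ with $f=2^r$ for some integer $r\geq 1$, and $b\in\mathbb{Z}$. Let $g$ be an odd integer that is a primitive root modulo $p^m$ (hence a common primitive root modulo $p^j$ and $2p^j$ for all $1\le j\le m$). Let $\mathbf{s}^\infty=\{s_i\}_{i\ge 0}$ be the binary sequence of period $2p^m$ defined by $s_i=1$ if $i \bmod 2p^m\in C_1$ and $s_i=0$ if $i\bmod 2p^m\in C_0$, where $$C_{0}=\bigcup_{j=1}^{m}\bigcup_{i=\delta_j}^{d_j-1} p^{m-j}\left(2D_{i+b}^{(p^{j})}\cup D_{i+b}^{(2p^{j})}\right)\cup \{p^{m}\},\qquad C_{1}=\bigcup_{j=1}^{m}\bigcup_{i=0}^{\delta_j-1} p^{m-j}\left(2D_{i+b}^{(p^{j})}\cup D_{i+b}^{(2p^{j})}\right)\cup\{0\}.$$ Then: (1) if $2^{e}\not\equiv \pm 1\pmod{p}$, or if $2^e\equiv 1\pmod{p}$ but $2^e\not\equiv 1\pmod{p^2}$, then $\mathrm{LC}(\mathbf{s}^{\infty})=2p^{m}$; (2) if $2^e\equiv -1\pmod{p}$ but $2^e\not\equiv -1\pmod{p^2}$, then $2p^m-2(p-1)\leq \mathrm{LC}(\mathbf{s}^{\infty})\leq 2p^{m}-(p-1)$.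
   Context: For $1\le j\le m$ put $d_j=\varphi(p^j)/e=p^{j-1}f$ and $\delta_j=d_j/2=p^{j-1}f/2$. For $i\in\mathbb{Z}$ and $s=p^j$ or $s=2p^j$, define $D_i^{(s)}=\{g^{i+d_jt} \bmod s : 0\le t<e\}$; it depends only on $i \bmod d_j$. For $(s,a)=(p^j,p^{m-j})$, $(p^j,2p^{m-j})$ or $(2p^j,p^{m-j})$ define $aD_i^{(s)}=\{a g^{i+d_jt}\bmod as : 0\le t<e\}$; thus $p^{m-j}\cdot 2D_i^{(p^j)}=\{2p^{m-j}g^{i+d_jt}\bmod 2p^m\}$ and $p^{m-j}D_i^{(2p^j)}=\{p^{m-j}g^{i+d_jt}\bmod 2p^m\}$. The sets $C_0$ and $C_1$ partition $\mathbb{Z}_{2p^m}=\mathbb{Z}/2p^m\mathbb{Z}$. The linear complexity $\mathrm{LC}(\mathbf{s}^\infty)$ of a binary sequence $\mathbf{s}^\infty=\{s_i\}_{i\geq 0}$ ($s_i\in\mathbb{F}_2$) of period $N$ is the smallest positive integer $l$ for which there are constants $c_1,\dots,c_l\in\mathbb{F}_2$ with $s_i=c_1s_{i-1}+c_2s_{i-2}+\cdots+c_ls_{i-l}$ for all $i\ge l$. Equivalently, $\mathrm{LC}(\mathbf{s}^\infty)=N-\deg\gcd(x^N-1,\ s_0+s_1x+\cdots+s_{N-1}x^{N-1})$, with the gcd taken in $\mathbb{F}_2[x]$. *)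

(* Defs.v *)
From HB Require Import structures.
From mathcomp Require Import all_boot all_order all_algebra.
(* Not imported: its [set ... | ...] notations would shadow those of finset. *)
From mathcomp Require classical_sets.

Set Implicit Arguments.
Unset Strict Implicit.
Unset Printing Implicit Defensive.

Import GRing.Theory.
Local Open Scope ring_scope.

(* The order of g in the unit group of Z/n is phi(n); meaningful for n > 1,
   where 'Z_n is Z/n. *)
Definition primitive_root_mod (n : nat) (g : int) : bool :=
  (totient n).-primitive_root (g%:~R : 'Z_n).

Definition cyc_d (p e j : nat) : nat := totient (p ^ j) %/ e.

Definition cyc_delta (p e j : nat) : nat := (cyc_d p e j)./2.

(* D_i^(s) = {g^(i + d_j t) mod s : 0 <= t < e}, for s = p^j or s = 2p^j.
   The exponent is an integer: negative powers are inverses in 'Z_s, where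
   the image of g is a unit. *)
Definition cyc_D (p e : nat) (g : int) (j s : nat) (i : int) : {set 'Z_s} :=
  [set (g%:~R : 'Z_s) ^ (i + (cyc_d p e j * t)%:Z) | t : 'I_e].

(* {a x mod N : x in A}; well defined on residues mod s, and independent of
   the representatives, whenever N = a s, as is the case in [cyc_union]. *)
Definition dilate (N a s : nat) (A : {set 'Z_s}) : {set 'Z_N} :=
  [set (a * x)%:R | x : 'Z_s in A].

(* p^(m-j) (2 D_i^(p^j) U D_i^(2p^j)), as a subset of Z/2p^m. *)
Definition cyc_union (p m e : nat) (g : int) (j : nat) (i : int) :
    {set 'Z_(2 * p ^ m)} :=
  dilate (2 * p ^ m) (2 * p ^ (m - j)) (cyc_D p e g j (p ^ j) i)
  :|: dilate (2 * p ^ m) (p ^ (m - j)) (cyc_D p e g j (2 * p ^ j) i).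

Definition cyc_C0 (p m e : nat) (g b : int) : {set 'Z_(2 * p ^ m)} :=
  (\bigcup_(1 <= j < m.+1) \bigcup_(cyc_delta p e j <= i < cyc_d p e j)
     cyc_union p m e g j (i%:Z + b))
  :|: [set (p ^ m)%:R].

Definition cyc_C1 (p m e : nat) (g b : int) : {set 'Z_(2 * p ^ m)} :=
  (\bigcup_(1 <= j < m.+1) \bigcup_(0 <= i < cyc_delta p e j)
     cyc_union p m e g j (i%:Z + b))
  :|: [set 0].

(* Only the values c 1, ..., c l are used. *)
Definition linear_recurrence (s : nat -> 'F_2) (l : nat) : Prop :=
  exists c : nat -> 'F_2,
    forall i : nat, (l <= i)%N -> s i = \sum_(1 <= k < l.+1) c k * s (i - k)%N.

Definition is_linear_complexity (s : nat -> 'F_2) (l : nat) : Prop :=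
  [/\ (0 < l)%N, linear_recurrence s l
    & forall k : nat, (0 < k)%N -> linear_recurrence s k -> (l <= k)%N].

(* The default value 0 is taken only when s satisfies no linear recurrence,
   which cannot happen for a periodic s. *)
Definition LC (s : nat -> 'F_2) : nat :=
  classical_sets.xget 0%N (is_linear_complexity s).

(* Main.v *)
Require Import Defs.
From mathcomp Require Import all_boot all_order all_algebra.
From mathcomp Require Import all_solvable all_field.
From mathcomp Require Import zify ring.
From mathcomp Require classical_sets.

(* Let n = p^m, G the image of g in Z/n, and S the generating polynomial of one
   period over F_2.  For an n-th root of unity x in the algebraic closure,
   S(x) = 1 + T(x) + T(x)^2, where T(x) is the sum of x^w over a "window" W of
   Z/n, and LC s = 2n - deg gcd((X^n - 1)^2, S).  Put delta = p^(m-1) f / 2.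
   Multiplication by G^delta exchanges W with its complement in the nonzero
   residues, so T(x^(G^delta)) = T(x) + 1 for x <> 1, while T(x^2) = T(x)^2.
   If S(x) = 0, then T(x) is in F_4 but not in F_2.  Writing 2 = G^u, the two
   rules are compatible only if f/2 divides u and f does not, that is, only if
   2^e = -1 mod p; this is (1).  In case (2) every x of order p is a root of S.
   If a root x had order p^k, k >= 2, then, since p does not divide u, T would be
   constant on the x^(1 + pz).  A Fourier transform in z turns this into the
   vanishing of the sum of x^w over the w in W congruent to g^b mod p^(k-1).
   These w are the first half of a progression g^b q^l, so that the sum is a
   nonzero truncated geometric sum, a contradiction. *)

Set Implicit Arguments.
Unset Strict Implicit.
Unset Printing Implicit Defensive.

Import GRing.Theory.
Local Open Scope ring_scope.

(** * Linear complexity and greatest common divisors *)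

(* The coefficient of X^i in the power series C * \sum_j s_j X^j. *)
Definition conv_coef (C : {poly 'F_2}) (s : nat -> 'F_2) (i : nat) : 'F_2 :=
  \sum_(k < i.+1) C`_k * s (i - k)%N.

(** By periodicity, one period of [s] is [1 - X^N] times the power series of [s]. Multiplying by
    [C], this coefficient is that of [C] times the series, minus the one [N] places earlier. *)
Lemma coef_mul_period (s : nat -> 'F_2) (N : nat) (C : {poly 'F_2}) (i : nat) :
  (forall j, s (j + N)%N = s j) ->
  (C * \poly_(j < N) s j)`_i =
    conv_coef C s i - (if (N <= i)%N then conv_coef C s (i - N) else 0).
Proof.
move=> sN; rewrite coefM /conv_coef; apply/eqP; rewrite eq_sym subr_eq; apply/eqP.
pose F k := if (k + N <= i)%N then C`_k * s (i - N - k)%N else 0.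
have -> : (if (N <= i)%N then \sum_(k < (i - N).+1) C`_k * s (i - N - k)%N
           else 0) = \sum_(k < i.+1) F k.
  case: leqP => Ni; last by rewrite big1 // => k _; rewrite /F; case: ifP => //; lia.
  rewrite -!(big_mkord xpredT (fun k => F k)).
  rewrite -(big_mkord xpredT (fun k => C`_k * s (i - N - k)%N)).
  rewrite [RHS](@big_cat_nat _ _ _ (i - N).+1) //=; last lia.
  rewrite [X in _ + X]big1_seq ?addr0.
    by apply: eq_big_nat => k /andP[_ ki]; rewrite /F ifT //; lia.
  by move=> k; rewrite mem_index_iota /F; case: ifP => //; lia.
rewrite -big_split /=; apply: eq_bigr => -[k /= ki] _.
rewrite coef_poly /F; case: ltnP => h; first by rewrite ifF ?addr0 //; lia.
rewrite ifT; last lia.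
by rewrite mulr0 add0r; congr (_ * _); rewrite -[RHS]sN; congr s; lia.
Qed.

Lemma conv_coef_eq (s : nat -> 'F_2) (l i : nat) (C : {poly 'F_2}) :
  (size C <= l.+1)%N -> (l <= i)%N ->
  conv_coef C s i = C`_0 * s i + \sum_(1 <= k < l.+1) C`_k * s (i - k)%N.
Proof.
move=> sC li; rewrite /conv_coef -(big_mkord xpredT (fun k => C`_k * s (i - k)%N)).
rewrite big_nat_recl // subn0; congr (_ + _).
rewrite (@big_cat_nat _ _ _ l) //= [X in _ + X]big1_seq ?addr0.
  by rewrite big_add1.
move=> k; rewrite mem_index_iota => /andP[_ /andP[lk _]].
by rewrite nth_default ?mul0r // (leq_trans sC).
Qed.

(** [C] is the connection polynomial, with constant term 1 and the [- c k] as further coefficients;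
    its product with the series of [s] is then a polynomial of size at most [l]. *)
Lemma linear_recurrenceP (s : nat -> 'F_2) (l : nat) :
  linear_recurrence s l <->
  exists C : {poly 'F_2}, [/\ (size C <= l.+1)%N, C`_0 = 1
    & forall i, (l <= i)%N -> conv_coef C s i = 0].
Proof.
split=> [[c rec]|[C [sC C0 rec]]].
  exists (\poly_(k < l.+1) (if k == 0%N then 1 else - c k)); split.
  - exact: size_poly.
  - by rewrite coef_poly.
  - move=> i li; rewrite (conv_coef_eq s (size_poly _ _) li) coef_poly /= mul1r rec //.
    rewrite -big_split /= big1_seq // => k; rewrite mem_index_iota => /andP[_ /andP[k1 kl]].
    by rewrite coef_poly kl ifF ?mulNr ?subrr //; lia.
exists (fun k => - C`_k) => i li.
have := rec i li; rewrite (conv_coef_eq s sC li) C0 mul1r => /eqP.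
rewrite addr_eq0 => /eqP ->; rewrite -sumrN; apply: eq_bigr => k _.
by rewrite mulNr.
Qed.

(** The series of [s] is -S/P, in lowest terms -S'/P', so connection polynomials are multiples of P'
    and the shortest recurrence has length deg P'. The bound on the size of the gcd makes this
    degree positive, as [is_linear_complexity] demands. *)
Lemma LC_gcdp (s : nat -> 'F_2) (N : nat) :
  (forall j, s (j + N)%N = s j) ->
  (0 < N)%N -> (size (gcdp ('X^N - 1) (\poly_(i < N) s i)) <= N)%N ->
  LC s = (N - (size (gcdp ('X^N - 1) (\poly_(i < N) s i))).-1)%N.
Proof.
move=> sN N0; set S := \poly_(i < N) s i; set P : {poly 'F_2} := 'X^N - 1.
set G := gcdp P S => sG.
have P0 : P != 0 by rewrite -size_poly_eq0 size_XnsubC.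
have G0 : G != 0 by rewrite gcdp_eq0 negb_and P0.
have [GP GS] : P = P %/ G * G /\ S = S %/ G * G.
  by split; rewrite divpK // (dvdp_gcdl, dvdp_gcdr).
set P' := P %/ G in GP; set S' := S %/ G in GS.
have sG0 : (0 < size G)%N by rewrite size_poly_gt0.
have sP' : size P' = (N.+1 - (size G).-1)%N by rewrite size_divp // size_XnsubC.
have cop : coprimep P' S' by rewrite coprimep_div_gcd ?P0.
have P'0 : P'`_0 != 0.
  have : P`_0 != 0 by rewrite coefB coefXn coef1 (ltn_eqF N0) sub0r oppr_eq0 oner_neq0.
  by rewrite {1}GP coef0M mulf_eq0 negb_or => /andP[].
apply: classical_sets.xget_subset1; last first.
  move=> k k' [k0 rk mk] [k0' rk' mk']; apply/eqP.
  by rewrite eqn_leq mk // mk'.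
split; first lia.
    apply/linear_recurrenceP; exists ((P'`_0)^-1 *: P'); split.
    - by rewrite size_scale ?invr_eq0 // sP'; lia.
    - by rewrite coefZ mulVf.
    set C := _ *: P'.
    have sS' : (size S' <= N - (size G).-1)%N.
      by rewrite size_divp // leq_sub2r // size_poly.
    (* [C] is P' normalised to constant term 1, so [C] times the series is a scalar multiple of S';
       the induction goes down by [N]. *)
    have key i : conv_coef C s i = - (P'`_0)^-1 * S'`_i.
      elim/ltn_ind: i => i IH.
      have := coef_mul_period C i sN; rewrite -/S.
      have -> : C * S = (P'`_0)^-1 *: (S' * 'X^N) - (P'`_0)^-1 *: S'.
        rewrite /C -scalerBr -scalerAl {1}GS; congr (_ *: _).
        by rewrite mulrCA -GP mulrBr mulr1.
      rewrite coefB !coefZ coefMXn => /esym /eqP.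
      rewrite subr_eq => /eqP ->; case: ltnP => Ni.
        by rewrite mulr0 sub0r addr0 mulNr.
      rewrite IH //; last lia.
      by rewrite mulNr addrAC subrr sub0r mulNr.
    by move=> i li; rewrite key [S'`_i]nth_default ?mulr0 // (leq_trans sS').
move=> k k0 /linear_recurrenceP [C [sC C0 rec]].
have C_neq0 : C != 0 by apply: contra_eq_neq C0 => ->; rewrite coef0 eq_sym oner_neq0.
(* Beyond [k] the product of [C] with the series vanishes, so it is a polynomial. Cancelling the gcd
   then leaves P' dividing C S', and coprimality makes P' divide [C]. *)
have CS : C * S = - \poly_(i < k) conv_coef C s i * P.
  apply/polyP => i; rewrite (coef_mul_period C i sN) mulNr -mulrN opprB mulrBr mulr1.
  rewrite coefB coefMXn !coef_poly.
  have z j : (if (j < k)%N then conv_coef C s j else 0) = conv_coef C s j.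
    by case: ltnP => // /rec ->.
  by rewrite !z; congr (_ - _); case: ltnP.
have : P' %| C * S'.
  apply/dvdpP; exists (- \poly_(i < k) conv_coef C s i).
  by apply: (mulIf G0); rewrite -!mulrA -GP -GS.
rewrite Gauss_dvdpl // => /(dvdp_leq C_neq0) /leq_trans /(_ sC); rewrite sP'; lia.
Qed.

(** * The sequence as a window of discrete logarithms *)

Lemma Zp_natP (n a b : nat) : (1 < n)%N ->
  (a%:R == b%:R :> 'Z_n) = (a == b %[mod n])%N.
Proof. by move=> n1; rewrite -val_eqE /= !val_Zp_nat. Qed.

(** Each p-th power gains a factor p: y^p - 1 is y - 1 times a sum of p powers of y, each congruent
    to 1 modulo p. *)
Lemma exp_mod1_lift (p n k x : nat) : (1 < p)%N -> (0 < n)%N ->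
  (x = 1 %[mod p ^ n] -> x ^ (p ^ k) = 1 %[mod p ^ (n + k)])%N.
Proof.
move=> p1 n0; elim: k => [|k IH] hx; first by rewrite addn0 expn0 expn1.
move: (IH hx); set y := (x ^ (p ^ k))%N => hy.
have -> : (x ^ (p ^ k.+1) = y ^ p)%N by rewrite /y -expnM -expnSr.
rewrite addnS expnSr; case: (posnP y) => [y0|y0].
  have : (p ^ (n + k) %| 1)%N by rewrite /dvdn -hy y0 mod0n.
  by rewrite dvdn1 -(expn0 p) eqn_exp2l // addn_eq0 -[n == _]negbK -lt0n n0.
have yp0 : (0 < y ^ p)%N by rewrite expn_gt0 y0.
apply/eqP; rewrite eqn_mod_dvd // subn1 predn_exp.
apply: dvdn_mul; first by rewrite -subn1 -eqn_mod_dvd //; apply/eqP.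
have hyp : y = 1 %[mod p].
  apply/eqP; rewrite eqn_mod_dvd //; move/eqP: hy; rewrite eqn_mod_dvd //.
  by apply: dvdn_trans; rewrite dvdn_exp // addn_gt0 n0.
rewrite /dvdn -modn_summ.
under eq_bigr => i _ do rewrite -modnXm hyp modnXm exp1n.
by rewrite modn_summ sum_nat_const card_ord muln1 modnn.
Qed.

(** The first [totient n] powers of [a] are distinct units, and there are only that many units. *)
Lemma primitive_root_generates (n a : nat) : (1 < n)%N ->
    (totient n).-primitive_root (a%:R : 'Z_n) ->
  forall y, coprime n y -> exists k, (y = a ^ k %[mod n])%N.
Proof.
move=> n1 prim y cy.
have t0 : (0 < totient n)%N by rewrite totient_gt0; lia.
have aU : (a%:R : 'Z_n) \is a GRing.unit.
  by rewrite -(unitrX_pos _ t0) (prim_expr_order prim) unitr1.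
have yU : (y%:R : 'Z_n) \is a GRing.unit by rewrite unitZpE.
pose u : {unit 'Z_n} := FinRing.unit _ aU.
pose v : {unit 'Z_n} := FinRing.unit _ yU.
pose h (i : 'I_(totient n)) := (u ^+ i)%g.
have h_inj : injective h.
  move=> i j /(congr1 val); rewrite /h !FinRing.val_unitX /= => /eqP.
  by rewrite (eq_prim_root_expr prim) !modn_small // => /eqP /val_inj.
have /codomP[i hi] : v \in codom h.
  apply: inj_card_onto => //; rewrite card_ord.
  by rewrite -[X in (X <= _)%N]cardsT card_units_Zp // ltnW.
exists i; apply/eqP; rewrite -Zp_natP // natrX; apply/eqP.
by move/(congr1 val): hi; rewrite /h FinRing.val_unitX.
Qed.

Lemma primitive_rootP (n a k l : nat) : (1 < n)%N ->
  (totient n).-primitive_root (a%:R : 'Z_n) ->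
  (a ^ k == a ^ l %[mod n])%N = (k == l %[mod totient n])%N.
Proof. by move=> n1 prim; rewrite -Zp_natP // !natrX (eq_prim_root_expr prim). Qed.

Lemma primitive_root_generates_from (n a b : nat) : (1 < n)%N ->
    (totient n).-primitive_root (a%:R : 'Z_n) ->
  forall y, coprime n y -> exists k, (y = a ^ (b + k) %[mod n])%N.
Proof.
move=> n1 prim y /(primitive_root_generates n1 prim)[k hk].
have t0 : (0 < totient n)%N by rewrite totient_gt0 ltnW.
(* Modulo [totient n] this exponent is k - b, written without subtraction. *)
exists (k + b * (totient n).-1)%N; rewrite hk; apply/eqP.
rewrite primitive_rootP //.
have -> : (b + (k + b * (totient n).-1) = b * totient n + k)%N.
  by rewrite -{2}(prednK t0); lia.
by rewrite modnMDl.
Qed.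

(** An odd multiple of [a] is [a] modulo [2 * a], and adding [a] exchanges the two halves. *)
Lemma half_window_shift (a q k : nat) : (0 < a)%N -> odd q ->
  (((k + q * a) %% (2 * a) < a) = ~~ (k %% (2 * a) < a))%N.
Proof.
move=> a0 oq; have -> : ((k + q * a) %% (2 * a) = (k %% (2 * a) + a) %% (2 * a))%N.
  rewrite -[q]odd_double_half oq modnDml.
  have -> : (k + (true + q./2.*2) * a = q./2 * (2 * a) + (k + a))%N by lia.
  by rewrite modnMDl.
have : (k %% (2 * a) < 2 * a)%N by rewrite ltn_mod; lia.
move: (k %% _)%N => j j2; case: (ltnP j a) => h; first by rewrite modn_small; lia.
have -> : (j + a = (j - a) + 2 * a)%N by lia.
by rewrite modnDr modn_small; lia.
Qed.

(** The left-hand exponent has the form used in [cyc_D]: [k] is divided by [d], the quotient reduced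
    modulo [e], and the integer shift is [b0] plus a multiple of the order bound [d * e]. *)
Lemma exprz_window (R : unitRingType) (h : R) (d e M k b0 : nat) (z : int) :
  h \is a GRing.unit -> h ^+ (d * e) = 1 -> (d * e %| M)%N ->
  h ^ ((k %% d)%:Z + (b0%:Z + z * M%:Z) + (d * ((k %/ d) %% e))%:Z) = h ^+ (b0 + k).
Proof.
move=> hU h1 /dvdnP[c ->].
rewrite !exprzDr // (mulrC z) -exprz_exp -!exprnP mulnC exprM h1 expr1n exp1rz mulr1.
set t := (k %/ d)%N.
have hk : h ^+ k = h ^+ (k %% d + d * (t %% e)).
  have {1}-> : (k = d * e * (t %/ e) + (k %% d + d * (t %% e)))%N.
    by rewrite {1}(divn_eq k d) -/t {1}(divn_eq t e); nia.
  by rewrite exprD exprM h1 expr1n mul1r.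
by rewrite -!exprD [RHS]exprD hk -exprD; congr (_ ^+ _); lia.
Qed.

Lemma mem_bigcup_nat (T : finType) (F : nat -> {set T}) (a b i : nat) (x : T) :
  (a <= i < b)%N -> x \in F i -> x \in \bigcup_(a <= j < b) F j.
Proof.
move=> ab xi; rewrite (bigD1_seq i) ?iota_uniq ?mem_index_iota //=.
by rewrite inE xi.
Qed.

Lemma mem_cyc_D (p e j s g0 b0 k M : nat) (g b z' : int) :
  (1 < s)%N -> coprime g0 s -> (0 < e)%N ->
  (totient s = cyc_d p e j * e)%N -> (totient s %| M)%N ->
  (s%:Z %| g - g0%:Z)%Z -> b = b0%:Z + z' * M%:Z ->
  ((g0 ^ (b0 + k))%:R : 'Z_s) \in cyc_D p e g j s ((k %% cyc_d p e j)%:Z + b).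
Proof.
move=> s1 cg e0 ts tM /dvdzP[c hg] ->.
have hgR : (g%:~R : 'Z_s) = g0%:R.
  have -> : g = g0%:Z + c * s%:Z by rewrite -hg; ring.
  by rewrite intrD intrM -!pmulrn pchar_Zp ?mulr0 ?addr0.
have gU : (g0%:R : 'Z_s) \is a GRing.unit by rewrite unitZpE // coprime_sym.
have g1 : (g0%:R : 'Z_s) ^+ (cyc_d p e j * e) = 1.
  rewrite -ts -natrX -[RHS]/(1%:R); apply/eqP; rewrite Zp_natP //.
  exact/eqP/Euler_exp_totient.
apply/imsetP; exists (Ordinal (ltn_pmod (k %/ cyc_d p e j) e0)) => //=.
rewrite hgR exprz_window // -?ts //.
by rewrite natrX.
Qed.

Lemma mem_dilate (N a s i c : nat) (A : {set 'Z_s}) :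
  (1 < s)%N -> (1 < N)%N -> (N = a * s)%N -> (c%:R : 'Z_s) \in A ->
  (i = a * c %[mod N])%N -> (i%:R : 'Z_N) \in dilate N a A.
Proof.
move=> s1 N1 NE cA ic; apply/imsetP; exists (c%:R) => //.
apply/eqP; rewrite Zp_natP //= val_Zp_nat // muln_modr -NE modn_mod ic //.
Qed.

(** Doubling [i] lands in the even part of the union. An odd [i] is determined modulo 2p^m by its
    residue modulo p^m, and p^(m-j) g0^(b0+k) is odd as well, so [i] lands in the odd part with the
    same index. *)
Lemma mem_cyc_union (p m e j g0 b0 k i : nat) (g b z' : int) :
  prime p -> odd p -> (1 <= j <= m)%N -> (0 < e)%N -> (e %| p.-1)%N ->
  odd g0 -> coprime g0 p -> ((2 * p ^ m)%:Z %| g - g0%:Z)%Z ->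
  b = b0%:Z + z' * (totient (p ^ m))%:Z ->
  (i = p ^ (m - j) * g0 ^ (b0 + k) %[mod p ^ m])%N ->
  let U := cyc_union p m e g j ((k %% cyc_d p e j)%:Z + b) in
  (2 * i)%:R \in U /\ (odd i -> i%:R \in U).
Proof.
move=> pp op /andP[j1 jm] e0 ep og cg hg hb hi U.
have pj1 : (1 < p ^ j)%N by rewrite -(exp1n j) ltn_exp2r ?prime_gt1.
have p2 : coprime 2 (p ^ j) by rewrite coprime2n oddX op orbT.
have hN : (p ^ m = p ^ (m - j) * p ^ j)%N by rewrite -expnD subnK.
have N1 : (1 < 2 * p ^ m)%N by rewrite (@leq_trans (2 * 1)) // leq_mul2l expn_gt0 prime_gt0.
have tj : (totient (p ^ j) = cyc_d p e j * e)%N.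
  by rewrite divnK // totient_pfactor // dvdn_mulr.
have t2j : totient (2 * p ^ j) = totient (p ^ j).
  by rewrite totient_coprime // mul1n.
have tm : (totient (p ^ j) %| totient (p ^ m))%N.
  rewrite !totient_pfactor ?(leq_trans j1) // dvdn_mul // dvdn_exp2l //.
  by rewrite -!subn1 leq_sub2r.
have dj : (p ^ j %| 2 * p ^ m)%N by rewrite hN mulnA dvdn_mull.
have d2j : (2 * p ^ j %| 2 * p ^ m)%N by rewrite hN mulnCA dvdn_mull.
split.
  rewrite inE; apply/orP; left.
  apply: (@mem_dilate _ _ (p ^ j) _ (g0 ^ (b0 + k)) _ pj1 N1).
  - by rewrite hN mulnA.
  - apply: (mem_cyc_D k pj1 _ e0 tj tm _ hb).
    + exact: coprimeXr.
    + by apply: dvdz_trans hg.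
  - by rewrite -mulnA; apply/eqP; rewrite -!muln_modr hi.
move=> oi; rewrite inE; apply/orP; right.
have s1 : (1 < 2 * p ^ j)%N.
  by rewrite (ltn_trans pj1) // -[X in (X < _)%N]mul1n ltn_pmul2r // ltnW.
apply: (@mem_dilate _ _ (2 * p ^ j) _ (g0 ^ (b0 + k)) _ s1 N1).
- by rewrite hN mulnCA.
- apply: (mem_cyc_D k s1 _ e0 _ _ _ hb); rewrite ?t2j //.
  + by rewrite coprimeMr coprimen2 og coprimeXr.
  + by apply: dvdz_trans hg.
- apply/eqP; rewrite chinese_remainder ?coprime2n ?oddX ?op ?orbT //.
  by rewrite hi eqxx andbT !modn2 oi oddM !oddX op og !orbT.
Qed.

Lemma cyc_dE (p e r j : nat) : prime p -> (0 < j)%N -> (0 < e)%N ->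
  (p - 1 = e * 2 ^ r)%N -> cyc_d p e j = (p ^ j.-1 * 2 ^ r)%N.
Proof.
move=> pp j0 e0 ef; rewrite /cyc_d totient_pfactor // -subn1 ef -mulnA mulKn //.
by rewrite mulnC.
Qed.

Lemma cyc_deltaE (p e r j : nat) : prime p -> (0 < j)%N -> (0 < e)%N ->
  (p - 1 = e * 2 ^ r.+1)%N -> cyc_delta p e j = (p ^ j.-1 * 2 ^ r)%N.
Proof.
move=> pp j0 e0 ef; rewrite /cyc_delta (cyc_dE pp j0 e0 ef) expnS mulnCA mul2n.
by rewrite doubleK.
Qed.

(** Here m - j is the p-adic valuation of [i], and the cofactor is a unit, hence a power of [g0]. *)
Lemma prime_pow_rep (p m g0 b0 i : nat) : prime p -> (0 < m)%N ->
  (totient (p ^ m)).-primitive_root (g0%:R : 'Z_(p ^ m)) -> ~~ (p ^ m %| i)%N ->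
  exists j k, (1 <= j <= m)%N /\ (i = p ^ (m - j) * g0 ^ (b0 + k) %[mod p ^ m])%N.
Proof.
move=> pp m0 prim ni.
have n1 : (1 < p ^ m)%N by rewrite -(exp1n m) ltn_exp2r ?prime_gt1.
have i0 : (0 < i)%N by case: i ni => //; rewrite dvdn0.
have [y cy iy] := pfactor_coprime pp i0.
set v := logn p i in iy.
have vm : (v < m)%N by rewrite ltnNge -pfactor_dvdn.
have [k hk] : exists k, (y = g0 ^ (b0 + k) %[mod p ^ m])%N.
  by apply: primitive_root_generates_from => //; rewrite coprime_pexpl.
exists (m - v)%N, k; rewrite subn_gt0 vm leq_subr; split=> //.
by rewrite subKn 1?ltnW // iy mulnC -modnMmr hk modnMmr.
Qed.

(** Since 2i and an odd i get the same symbol, one window [W] on Z/p^m describes the whole sequence,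
    apart from the multiples of p^m. The exponent [r] is one less than in the theorem, so that f/2 =
    2^r and [delta] is the half-length at level m. *)
Lemma exists_window (p m e r : nat) (b g : int) (s : nat -> 'F_2) :
  prime p -> odd p -> (0 < m)%N -> (p - 1 = e * 2 ^ r.+1)%N ->
  ~~ (2 %| g)%Z -> primitive_root_mod (p ^ m) g ->
  (forall i : nat, (i%:R : 'Z_(2 * p ^ m)) \in cyc_C1 p m e g b -> s i = 1) ->
  (forall i : nat, (i%:R : 'Z_(2 * p ^ m)) \in cyc_C0 p m e g b -> s i = 0) ->
  let delta := (p ^ m.-1 * 2 ^ r)%N in
  exists g0 b0 : nat, exists W : 'Z_(p ^ m) -> bool,
  [/\ (totient (p ^ m)).-primitive_root (g0%:R : 'Z_(p ^ m)),
      forall x, W (g0%:R ^+ delta * x) = (x != 0) && ~~ W x,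
      forall k, W (g0%:R ^+ (b0 + k)) = (k %% (2 * delta) < delta)%N,
      forall i, s (2 * i)%N = if (p ^ m %| i)%N then 1 else (W i%:R)%:R
    & forall i, odd i -> s i = if (p ^ m %| i)%N then 0 else (W i%:R)%:R].
Proof.
move=> pp op m0 ef og prim sC1 sC0 delta.
have e0 : (0 < e)%N by case: e ef {sC1 sC0} => //; have := prime_gt1 pp; lia.
have n1 : (1 < p ^ m)%N by rewrite -(exp1n m) ltn_exp2r ?prime_gt1.
have N1 : (1 < 2 * p ^ m)%N by rewrite (@leq_trans (2 * 1)) // leq_mul2l ltnW.
have N0 : (2 * p ^ m)%:Z != 0 by rewrite eqz_nat -lt0n ltnW.
have t0 : (0 < totient (p ^ m))%N by rewrite totient_gt0 ltnW.
(* The reduction is modulo 2p^m, not p^m, so that [g0] stays odd. *)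
pose g0 := `|(g %% (2 * p ^ m)%:Z)%Z|%N.
have hg0 : g0%:Z = (g %% (2 * p ^ m)%:Z)%Z by rewrite gez0_abs ?modz_ge0.
have hg : ((2 * p ^ m)%:Z %| g - g0%:Z)%Z.
  apply/dvdzP; exists (g %/ (2 * p ^ m)%:Z)%Z; rewrite hg0.
  by rewrite {1}(divz_eq g (2 * p ^ m)%:Z) addrK.
pose b0 := `|(b %% (totient (p ^ m))%:Z)%Z|%N.
have t0z : (totient (p ^ m))%:Z != 0 by rewrite eqz_nat -lt0n.
have hb : b = b0%:Z + (b %/ (totient (p ^ m))%:Z)%Z * (totient (p ^ m))%:Z.
  by rewrite /b0 gez0_abs ?modz_ge0 // addrC -divz_eq.
have prim0 : (totient (p ^ m)).-primitive_root (g0%:R : 'Z_(p ^ m)).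
  suff -> : (g0%:R : 'Z_(p ^ m)) = g%:~R by [].
  have /dvdzP[c hc] := hg.
  have -> : g = g0%:Z + c * (2 * p ^ m)%:Z by rewrite -hc; ring.
  by rewrite intrD intrM PoszM intrM -!pmulrn pchar_Zp // !mulr0 addr0.
have og0 : odd g0.
  have : ~~ (2 %| g0%:Z)%Z.
    apply: contra og => h; rewrite -[g](subrK g0%:Z) rpredD //; apply: dvdz_trans hg.
    by rewrite PoszM dvdz_mulr.
  by rewrite dvdzE /= dvdn2 negbK.
have cg0 : coprime g0 p.
  have : (g0%:R : 'Z_(p ^ m)) \is a GRing.unit.
    by rewrite -(unitrX_pos _ t0) (prim_expr_order prim0) unitr1.
  by rewrite unitZpE // coprime_pexpl // coprime_sym.
have ep : (e %| p.-1)%N by rewrite -subn1 ef dvdn_mulr.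
have sval j k i : (1 <= j <= m)%N -> (i = p ^ (m - j) * g0 ^ (b0 + k) %[mod p ^ m])%N ->
    let v := ((k %% cyc_d p e j < cyc_delta p e j)%N)%:R in
    s (2 * i)%N = v /\ (odd i -> s i = v).
  move=> jm hi v.
  have j0 : (0 < j)%N by case/andP: jm.
  have [U1 U2] := mem_cyc_union pp op jm e0 ep og0 cg0 hg hb hi.
  suff aux x : (x%:R : 'Z_(2 * p ^ m)) \in
      cyc_union p m e g j ((k %% cyc_d p e j)%:Z + b) -> s x = v.
    by split; [exact: aux | move/U2/aux].
  have d0 : (0 < cyc_d p e j)%N by rewrite (cyc_dE pp j0 e0 ef) muln_gt0 !expn_gt0 prime_gt0.
  move=> xU; rewrite /v; case: ltnP => h; [apply: sC1 | apply: sC0];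
    rewrite inE; apply/orP; left; apply: (mem_bigcup_nat (i := j)) => //;
    apply: (mem_bigcup_nat (i := (k %% cyc_d p e j)%N)); rewrite // h /= ?ltn_mod //.
have W0 (i : nat) : ((i%:R : 'Z_(p ^ m)) == 0) = (p ^ m %| i)%N.
  by rewrite -[0]/(0%:R) Zp_natP // mod0n.
(* The window is read off the even positions; 0 is excluded because it lies in C_1 by fiat. *)
pose W (x : 'Z_(p ^ m)) := (x != 0) && (s (2 * x)%N == 1).
have Wn j k i : (1 <= j <= m)%N -> (i = p ^ (m - j) * g0 ^ (b0 + k) %[mod p ^ m])%N ->
    W i%:R = (i%:R != 0 :> 'Z_(p ^ m)) && (k %% (2 * (p ^ j.-1 * 2 ^ r)) < p ^ j.-1 * 2 ^ r)%N.
  move=> jm hi; have j0 : (0 < j)%N by case/andP: jm.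
  rewrite /W val_Zp_nat //.
  have [-> _] := sval j k (i %% p ^ m)%N jm (etrans (modn_mod _ _) hi).
  rewrite (cyc_dE pp j0 e0 ef) (cyc_deltaE pp j0 e0 ef) expnS mulnCA.
  by case: ltnP.
have sW i : ~~ (p ^ m %| i)%N -> s (2 * i)%N = (W i%:R)%:R /\ (odd i -> s i = (W i%:R)%:R).
  move=> ni; have [j [k [jm hi]]] := prime_pow_rep b0 pp m0 prim0 ni.
  have j0 : (0 < j)%N by case/andP: jm.
  rewrite (Wn _ _ _ jm hi) W0 ni /= mulnCA -expnS -(cyc_dE pp j0 e0 ef).
  by rewrite -(cyc_deltaE pp j0 e0 ef); exact: sval.
exists g0, b0, W; split=> //.
- move=> x; have [->|x0] := eqVneq x 0; first by rewrite mulr0 /W eqxx.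
  have : ~~ (p ^ m %| x)%N by rewrite -W0 natr_Zp.
  move=> nx; have [j [k [jm hi]]] := prime_pow_rep b0 pp m0 prim0 nx.
  have hx : (g0 ^ delta * x = p ^ (m - j) * g0 ^ (b0 + (k + delta)) %[mod p ^ m])%N.
    by rewrite -modnMmr hi modnMmr addnA (expnD _ _ delta) mulnCA [(g0 ^ delta * _)%N]mulnC.
  have -> : g0%:R ^+ delta * x = (g0 ^ delta * x)%:R by rewrite natrM natrX natr_Zp.
  rewrite (Wn _ _ _ jm hx) -[in RHS](natr_Zp x) (Wn _ _ _ jm hi) natr_Zp x0 natrM natr_Zp.
  have gU : (g0%:R : 'Z_(p ^ m)) ^+ delta \is a GRing.unit.
    by rewrite unitrX // -(unitrX_pos _ t0) (prim_expr_order prim0) unitr1.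
  rewrite natrX -(mulr0 (g0%:R ^+ delta)) (inj_eq (mulrI gU)) x0 /=.
  (* At every level j, [delta] is an odd multiple of the half-length at that level, so one shift
     complements all levels at once. *)
  have -> : delta = (p ^ (m - j) * (p ^ j.-1 * 2 ^ r))%N.
    rewrite mulnA -expnD /delta; congr (p ^ _ * _)%N.
    by case/andP: jm; clear; lia.
  by rewrite half_window_shift ?muln_gt0 ?expn_gt0 ?prime_gt0 // oddX op orbT.
- move=> k; rewrite -natrX (Wn m k); last first.
  + by rewrite subnn mul1n.
  + by rewrite m0 /=.
  rewrite W0; suff -> : ~~ (p ^ m %| g0 ^ (b0 + k))%N by [].
  have : coprime p (g0 ^ (b0 + k)) by rewrite coprimeXr // coprime_sym.
  by rewrite prime_coprime //; apply: contra; apply: dvdn_trans; rewrite dvdn_exp.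
- move=> i; case: ifPn => [di|ni]; last by have [] := sW i ni.
  apply: sC1; rewrite inE; apply/orP; right; rewrite inE -[0]/(0%:R) Zp_natP //.
  by rewrite mod0n -/(dvdn _ _) dvdn_pmul2l.
move=> i oi; case: ifPn => [/dvdnP[c hc]|ni]; last by have [_ ->] := sW i ni.
apply: sC0; rewrite inE; apply/orP; right; rewrite inE Zp_natP // hc.
have oc : odd c by move: oi; rewrite hc oddM => /andP[].
by rewrite -[c]odd_double_half oc mulnDl mul1n -mul2n addnC -mulnA mulnCA modnMDl.
Qed.

(** * Values at roots of unity in characteristic 2 *)

Lemma expr_eq_mod (K : nzRingType) (n a b : nat) (x : K) :
  x ^+ n = 1 -> (a = b %[mod n])%N -> x ^+ a = x ^+ b.
Proof. by move=> x1 ab; rewrite -(expr_mod a x1) ab expr_mod. Qed.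

Lemma sum_Zp_expr (K : fieldType) (n : nat) (x : K) : (1 < n)%N -> x ^+ n = 1 ->
  \sum_(z : 'Z_n) x ^+ z = if x == 1 then n%:R else 0.
Proof.
move=> n1 xn; case: eqP => [->|/eqP x1].
  under eq_bigr do rewrite expr1n.
  by rewrite sumr_const card_ord Zp_cast.
have : (x - 1) * \sum_(z : 'Z_n) x ^+ z = 0.
  by rewrite -subrX1 Zp_cast // xn subrr.
by move/eqP; rewrite mulf_eq0 subr_eq0 (negPf x1) => /eqP.
Qed.

Lemma expr_coprime_eq1 (K : nzRingType) (n a : nat) (x : K) : (0 < n)%N ->
  x ^+ n = 1 -> x ^+ a = 1 -> coprime n a -> x = 1.
Proof.
move=> n0 xn xa cop; have [d xd _] := prim_order_exists n0 xn.
have : (d %| gcdn n a)%N by rewrite dvdn_gcd !(prim_order_dvd xd) xn xa eqxx.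
by rewrite (eqP cop) dvdn1 => /eqP d1; move: (prim_expr_order xd); rewrite d1 expr1.
Qed.

Lemma prime_pow_order (K : nzRingType) (p k : nat) (x : K) : prime p ->
  x ^+ (p ^ k.+1) = 1 -> x ^+ (p ^ k) != 1 -> (p ^ k.+1).-primitive_root x.
Proof.
move=> pp x1 nx; have k0 : (0 < p ^ k.+1)%N by rewrite expn_gt0 prime_gt0.
have [d xd] := prim_order_exists k0 x1.
case/(dvdn_pfactor _ _ pp) => a; rewrite leq_eqVlt => /orP[/eqP-> <- //|ak dE].
case/negP: nx; rewrite -(prim_order_dvd xd) dE; exact: dvdn_exp2l.
Qed.

Lemma mod_inverse (a n : nat) : (0 < n)%N -> coprime a n ->
  exists c, (a * c = 1 %[mod n])%N.
Proof.
move=> n0 cop; exists (a ^ (totient n).-1)%N.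
by rewrite -expnS prednK ?totient_gt0 // Euler_exp_totient.
Qed.

Lemma eqn_mod_pmul2l (c a b n : nat) : (0 < n)%N -> coprime c n ->
  (c * a == c * b %[mod n])%N = (a == b %[mod n])%N.
Proof.
move=> n0 /(mod_inverse n0)[d cd]; apply/eqP/eqP => ab; last by rewrite -modnMmr ab modnMmr.
have dK x : (x = d * (c * x) %[mod n])%N.
  by rewrite mulnA [(d * c)%N]mulnC -modnMml cd modnMml mul1n.
by rewrite dK -modnMmr ab modnMmr -dK.
Qed.

Lemma ltn_double_odd (i a : nat) : odd a -> (2 * i < a)%N = (i < a./2.+1)%N.
Proof. by move=> oa; rewrite -{1}[a]odd_double_half oa; apply/idP/idP; lia. Qed.

Section GaussPeriods.

Variables (p m r g0 : nat).
Hypotheses (p_prime : prime p) (p_odd : odd p) (m_gt0 : (0 < m)%N).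
Let n := (p ^ m)%N.
Let delta := (p ^ m.-1 * 2 ^ r)%N.
Hypothesis g0_prim : (totient n).-primitive_root (g0%:R : 'Z_n).

Lemma expn_prime_gt1 : (1 < n)%N.
Proof. by rewrite /n -(exp1n m) ltn_exp2r ?prime_gt1. Qed.

Lemma expn_odd : odd n. Proof. by rewrite /n oddX p_odd orbT. Qed.

Lemma g0_unit : (g0%:R : 'Z_n) \is a GRing.unit.
Proof.
have t0 : (0 < totient n)%N by rewrite totient_gt0 ltnW ?expn_prime_gt1.
by rewrite -(unitrX_pos _ t0) (prim_expr_order g0_prim) unitr1.
Qed.

(** A primitive root modulo p^m stays primitive modulo p^a: raising to the power p^(m-a) lifts a
    congruence to 1 from p^a to p^m, where the order of [g0] is known. *)
Lemma g0_exp_eq1 a k : (0 < a <= m)%N ->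
  (g0 ^ k == 1 %[mod p ^ a])%N = (p ^ a.-1 * p.-1 %| k)%N.
Proof.
case/andP=> a0 am.
have p0 := prime_gt0 p_prime.
have cg : coprime g0 (p ^ a).
  have := g0_unit; rewrite unitZpE ?expn_prime_gt1 // coprime_sym => h.
  by apply: coprime_dvdr h; rewrite dvdn_exp2l.
apply/idP/idP => [/eqP h|/dvdnP[c ->]]; last first.
  have <- : totient (p ^ a) = (p ^ a.-1 * p.-1)%N by rewrite totient_pfactor // mulnC.
  by rewrite mulnC expnM -modnXm Euler_exp_totient // modnXm exp1n.
have := exp_mod1_lift (m - a) (prime_gt1 p_prime) a0 h; rewrite subnKC // -expnM => h2.
have : (g0 ^ (k * p ^ (m - a)) == g0 ^ 0 %[mod n])%N by rewrite expn0; apply/eqP.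
rewrite primitive_rootP ?expn_prime_gt1 // mod0n -/(dvdn _ _) totient_pfactor // => h3.
have hm : (p ^ m.-1 = p ^ a.-1 * p ^ (m - a))%N.
  rewrite -expnD; congr (p ^ _)%N; move: a0 am; clear; lia.
by move: h3; rewrite hm mulnA dvdn_pmul2r ?expn_gt0 ?p0 // mulnC.
Qed.

(** * The discrete logarithm of 2 *)

Variable u : nat.
Hypothesis two_g0 : (2 = g0 ^ u %[mod n])%N.

Lemma two_g0X j : (2 ^ j = g0 ^ (u * j) %[mod n])%N.
Proof. by rewrite expnM -modnXm two_g0 modnXm. Qed.

Lemma two_exp_eq1 e c : (p - 1 = e * 2 ^ r.+1)%N ->
  (2 ^ (e * c) == 1 %[mod p])%N = (2 ^ r.+1 %| u * c)%N.
Proof.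
move=> ef; have e0 : (0 < e)%N.
  case: e ef => // p1; move: (prime_gt1 p_prime).
  by rewrite -subn_gt0 p1 mul0n.
have pn : (p %| n)%N by rewrite dvdn_exp.
rewrite -(modn_dvdm _ pn) two_g0X (modn_dvdm _ pn).
have := g0_exp_eq1 (u * (e * c)) (a := 1); rewrite m_gt0 expn1 => -> //=.
by rewrite mul1n -subn1 ef mulnCA dvdn_pmul2l.
Qed.

(** The divisibility gives 2^(2e) = 1 modulo p, and 2^(2e) - 1 factors as a difference of
    squares. *)
Lemma two_index_sqr1 e : (p - 1 = e * 2 ^ r.+1)%N -> (2 ^ r %| u)%N ->
  (p %| 2 ^ e - 1)%N || (p %| 2 ^ e + 1)%N.
Proof.
move=> ef ru; rewrite -Euclid_dvdM // -subn_sqr exp1n -expnM.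
by rewrite -eqn_mod_dvd ?expn_gt0 // two_exp_eq1 // expnSr dvdn_mul.
Qed.

(** Squaring gives the divisibility by 2^r. One more factor 2 in [u] would give 2^e = 1, and p would
    divide 2. *)
Lemma two_index_opp1 e : (p - 1 = e * 2 ^ r.+1)%N -> (p %| 2 ^ e + 1)%N ->
  (2 ^ r %| u)%N && ~~ (2 ^ r.+1 %| u)%N.
Proof.
move=> ef pe; have : (p %| 2 ^ (e * 2) - 1)%N.
  by rewrite expnM -(exp1n 2) subn_sqr dvdn_mull.
rewrite -eqn_mod_dvd ?expn_gt0 // two_exp_eq1 // expnSr.
rewrite dvdn_pmul2r // => -> /=; rewrite -expnSr.
apply/negP => ru; have := two_exp_eq1 1 ef; rewrite !muln1 ru eqn_mod_dvd ?expn_gt0 //.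
move=> p1; have e2 : (2 ^ e + 1 - (2 ^ e - 1) = 2)%N.
  by rewrite subnBA ?expn_gt0 // -addnA addKn.
have := dvdn_sub pe p1; rewrite e2.
by rewrite dvdn_prime2 // => /eqP p2; move: p_odd; rewrite p2.
Qed.

(** If p divided [u], then p 2^r would too, forcing 2^(2e) = 1 modulo p^2; the factor 2^e - 1 is
    prime to p, so p^2 would divide 2^e + 1. With [1 < m], the relation between 2 and [g0] can be
    read modulo p^2. *)
Lemma two_index_prime e : (1 < m)%N -> (p - 1 = e * 2 ^ r.+1)%N ->
  (p %| 2 ^ e + 1)%N -> ~~ (p ^ 2 %| 2 ^ e + 1)%N -> ~~ (p %| u)%N.
Proof.
move=> m1 ef pe; apply: contra => pu.
have /andP[ru nru] := two_index_opp1 ef pe.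
have pru : (p * 2 ^ r %| u)%N by rewrite Gauss_dvd ?pu // coprimeXr // coprimen2.
have pn : (p ^ 2 %| n)%N by rewrite dvdn_exp2l.
have : (2 ^ (e * 2) == 1 %[mod p ^ 2])%N.
  rewrite -(modn_dvdm _ pn) two_g0X (modn_dvdm _ pn) g0_exp_eq1 //= expn1 -subn1 ef.
  by rewrite mulnCA [(u * _)%N]mulnCA expnSr dvdn_mul // mulnA dvdn_mul.
rewrite eqn_mod_dvd ?expn_gt0 // expnM -(exp1n 2) subn_sqr exp1n Gauss_dvdr //.
rewrite coprimeXl // prime_coprime // -eqn_mod_dvd ?expn_gt0 //.
by have := two_exp_eq1 1 ef; rewrite !muln1 => ->.
Qed.

(** * Window sums at roots of unity *)

Variable K : fieldType.
Hypothesis char2 : 2 \in [pchar K].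

Variable W : 'Z_n -> bool.
Hypothesis W_shift : forall x, W (g0%:R ^+ delta * x) = (x != 0) && ~~ W x.

(** This is the T(x) of the overview. *)
Definition period (x : K) : K := \sum_(z | W z) x ^+ z.

Lemma natr_char2 k : k%:R = (odd k)%:R :> K.
Proof.
rewrite -{1}[k]odd_double_half -muln2 natrD natrM.
by rewrite (pcharf0 char2) mulr0 addr0.
Qed.

Lemma addrr_char2 (x : K) : x + x = 0.
Proof. exact: addrr_pchar2. Qed.

Lemma expr_ZpM (x : K) (a : nat) (z : 'Z_n) : x ^+ n = 1 ->
  x ^+ (a%:R * z)%R = (x ^+ a) ^+ z.
Proof.
move=> xn; rewrite -exprM; apply: (expr_eq_mod xn).
rewrite -[in LHS](natr_Zp z) -natrM val_Zp_nat ?expn_prime_gt1 //.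
by rewrite modn_mod.
Qed.

Lemma period_frob x : period (x ^+ 2) = period x ^+ 2.
Proof.
rewrite /period -[RHS](pFrobenius_autE char2) rmorph_sum; apply: eq_bigr => z _.
by rewrite /= pFrobenius_autE exprAC.
Qed.

Lemma period_frobX x j : period (x ^+ (2 ^ j)) = period x ^+ (2 ^ j).
Proof.
elim: j => [|j IH]; first by rewrite !expr1.
by rewrite expnSr !exprM period_frob IH.
Qed.

(** The two periods together run over all nonzero exponents, because the shift carries the window to
    its complement there. The sum over all exponents vanishes, so the nonzero ones give -1 = 1. *)
Lemma period_shift x : x ^+ n = 1 -> x != 1 ->
  period (x ^+ (g0 ^ delta)) = period x + 1.
Proof.
move=> xn x1.
have gU : (g0%:R ^+ delta : 'Z_n) \is a GRing.unit by rewrite unitrX ?g0_unit.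
pose F (z : 'Z_n) := x ^+ z.
have inj : injective (fun z : 'Z_n => g0%:R ^+ delta * z) by exact: mulrI.
have h1 : period (x ^+ (g0 ^ delta)) = \sum_(z | W z) F (g0%:R ^+ delta * z).
  by apply: eq_bigr => z _; rewrite /F -natrX expr_ZpM.
have h2 : period x = \sum_(z | (z != 0) && ~~ W z) F (g0%:R ^+ delta * z).
  rewrite /period (reindex_inj inj) /=.
  by apply: eq_bigl => z; rewrite W_shift.
have W0 : W 0 = false by rewrite -(mulr0 (g0%:R ^+ delta)) W_shift eqxx.
have : period (x ^+ (g0 ^ delta)) + period x = \sum_(z | z != 0) F (g0%:R ^+ delta * z).
  rewrite h1 h2 [RHS](bigID W) /=; congr (_ + _).
  apply: eq_bigl => z; case: (eqVneq z 0) => [->|]; rewrite ?W0 //.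
have -> : \sum_(z | z != 0) F (g0%:R ^+ delta * z) = \sum_(z | z != 0) F z.
  rewrite [RHS](reindex_inj inj) /=; apply: eq_bigl => z.
  by rewrite -{2}(mulr0 (g0%:R ^+ delta)) (inj_eq inj).
have := sum_Zp_expr expn_prime_gt1 xn; rewrite (negPf x1) (bigD1 0) //= expr0 => /eqP.
rewrite addr_eq0 => /eqP s1 s2.
have {}s1 : \sum_(z : 'Z_n | z != 0) F z = 1.
  by rewrite -[LHS]opprK -s1 (oppr_pchar2 char2).
by rewrite s1 in s2; rewrite -s2 addrCA addrr_char2 addr0.
Qed.

Lemma expr_g0_neq1 (x : K) k : x ^+ n = 1 -> x != 1 -> x ^+ (g0 ^ k) != 1.
Proof.
move=> xn; apply: contra => /eqP h; apply/eqP.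
apply: (expr_coprime_eq1 (ltnW expn_prime_gt1) xn h).
by have := unitZpE (g0 ^ k) expn_prime_gt1; rewrite natrX unitrX ?g0_unit // => <-.
Qed.

Lemma period_shiftX x j : x ^+ n = 1 -> x != 1 ->
  period (x ^+ (g0 ^ (delta * j))) = period x + j%:R.
Proof.
move=> xn x1; elim: j => [|j IH]; first by rewrite muln0 expn0 expr1 addr0.
rewrite mulnS addnC expnD exprM period_shift; last 2 first.
- by rewrite -exprM mulnC exprM xn expr1n.
- exact: expr_g0_neq1.
by rewrite IH -addrA natr1.
Qed.

Lemma quadratic_expr_pow2 (t : K) j : 1 + t + t ^+ 2 = 0 ->
  t ^+ (2 ^ j) = t + j%:R.
Proof.
move=> t2; have {}t2 : t ^+ 2 = t + 1.
  by apply/eqP; rewrite -subr_eq0 (oppr_pchar2 char2) addrC [t + 1]addrC t2.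
elim: j => [|j IH]; first by rewrite expr1 addr0.
rewrite expnSr exprM IH -(pFrobenius_autE char2) rmorphD rmorph_nat /=.
by rewrite pFrobenius_autE t2 -addrA nat1r.
Qed.

(** The period of x^(2^j) is computed twice: Frobenius gives T(x) + j, and [c] shifts by [delta]
    give T(x) + c. *)
Lemma quadratic_parity x j c : x ^+ n = 1 -> x != 1 ->
  1 + period x + period x ^+ 2 = 0 -> (u * j = delta * c)%N -> odd j = odd c.
Proof.
move=> xn x1 t2 ujc.
have := period_frobX x j; rewrite (expr_eq_mod xn (two_g0X j)) ujc period_shiftX //.
rewrite (quadratic_expr_pow2 j t2) => /addrI; rewrite [j%:R]natr_char2 [c%:R]natr_char2.
by case: (odd j); case: (odd c) => // /eqP; rewrite ?oner_eq0 // eq_sym oner_eq0.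
Qed.

Lemma quadratic_index x : x ^+ n = 1 -> x != 1 ->
  1 + period x + period x ^+ 2 = 0 -> (2 ^ r %| u)%N && ~~ (2 ^ r.+1 %| u)%N.
Proof.
move=> xn x1 t2; apply/andP; split; last first.
  apply/negP => /dvdnP[c uc].
  (* If 2^(r+1) divides [u], an odd number of squarings equals an even number of shifts. *)
  have := @quadratic_parity x (p ^ m.-1) (2 * c) xn x1 t2.
  rewrite oddX p_odd orbT oddM /= => h; suff: true = false by [].
  by apply: h; rewrite uc /delta expnS; ring.
apply/negPn/negP => ru.
have u0 : (0 < u)%N by case: (posnP u) ru => // ->; rewrite dvdn0.
have [w cw uw] := pfactor_coprime (isT : prime 2) u0.
set v := logn 2 u in uw.
have vr : (v < r)%N by rewrite ltnNge -pfactor_dvdn.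
(* If only 2^v with v < r divides [u], an even number of squarings equals the odd number [w] of
   shifts. *)
have := @quadratic_parity x (2 ^ (r - v) * p ^ m.-1) w xn x1 t2.
rewrite oddM oddX subn_eq0 leqNgt vr /= => h.
move: cw; rewrite coprime2n -h // uw mulnA -[(w * 2 ^ v * _)%N]mulnA -expnD subnKC 1?ltnW //.
by rewrite /delta; ring.
Qed.

(** By Fermat, x^2 is also x^(2^(p^(m-1))), which is an odd number of shifts of x; hence T(x)^2 =
    T(x) + 1. *)
Lemma quadratic_order_p x : x ^+ p = 1 -> x != 1 ->
  (2 ^ r %| u)%N && ~~ (2 ^ r.+1 %| u)%N -> 1 + period x + period x ^+ 2 = 0.
Proof.
move=> xp x1 /andP[/dvdnP[c uc] nu].
have oc : odd c.
  apply: contraR nu => /negPf ec; rewrite uc -[c]odd_double_half ec add0n -mul2n.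
  by rewrite mulnAC -expnS dvdn_mulr.
have xn : x ^+ n = 1 by rewrite /n -(prednK m_gt0) expnS exprM xp expr1n.
have fermat k : (2 ^ (p ^ k) = 2 %[mod p])%N.
  elim: k => [|k IH]; first by rewrite expn1.
  by rewrite expnSr expnM fermat_little.
rewrite -period_frob -(expr_eq_mod xp (fermat m.-1)).
rewrite (expr_eq_mod xn (two_g0X _)).
have -> : (u * p ^ m.-1 = delta * c)%N by rewrite uc /delta; ring.
rewrite period_shiftX // natr_char2 oc.
by rewrite [period x + 1]addrC addrr_char2.
Qed.

Lemma period_mod x a b : x ^+ n = 1 -> x != 1 -> (a = b %[mod 2 * delta])%N ->
  period (x ^+ (g0 ^ a)) = period (x ^+ (g0 ^ b)).
Proof.
move=> xn x1; suff aux c : period (x ^+ (g0 ^ c)) = period (x ^+ (g0 ^ (c %% (2 * delta)))).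
  by move=> ab; rewrite aux ab -aux.
have {1}-> : (c = c %% (2 * delta) + delta * (2 * (c %/ (2 * delta))))%N.
  by rewrite {1}(divn_eq c (2 * delta)); ring.
rewrite expnD exprM period_shiftX ?expr_g0_neq1 //; last first.
  by rewrite -exprM mulnC exprM xn expr1n.
by rewrite natrM (pcharf0 char2) mul0r addr0.
Qed.

(** Write 1 + pz = g0^k; then p - 1, hence 2^(r+1), divides k. With u = u' 2^r and u' invertible
    modulo p^(m-1), k is congruent modulo 2 delta to u j for an even j. So the period equals that of
    x^(2^j), which is T(x) + j = T(x). *)
Lemma period_invariant x z e : x ^+ n = 1 -> x != 1 ->
  1 + period x + period x ^+ 2 = 0 -> (p - 1 = e * 2 ^ r.+1)%N ->
  ~~ (p %| u)%N -> period (x ^+ (1 + p * z)) = period x.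
Proof.
move=> xn x1 t2 ef pu.
have /andP[/dvdnP[u' uu'] _] := quadratic_index xn x1 t2.
have [k hk] : exists k, (1 + p * z = g0 ^ k %[mod n])%N.
  apply: (primitive_root_generates expn_prime_gt1 g0_prim).
  rewrite coprime_pexpl // prime_coprime // dvdn_addl ?dvdn_mulr // dvdn1.
  by rewrite gtn_eqF ?prime_gt1.
have : (p ^ 0 * p.-1 %| k)%N.
  rewrite -(g0_exp_eq1 (a := 1)) ?m_gt0 // expn1.
  have pn : (p %| n)%N by rewrite dvdn_exp.
  by rewrite -(modn_dvdm _ pn) -hk (modn_dvdm _ pn) addnC mulnC modnMDl.
rewrite mul1n => /dvdnP[k' kk'].
have [c hc] : exists c, (u' * c = 1 %[mod p ^ m.-1])%N.
  apply: mod_inverse; first by rewrite expn_gt0 prime_gt0.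
  apply: coprimeXr; rewrite coprime_sym prime_coprime //.
  by apply: contra pu => pu'; rewrite uu' dvdn_mulr.
rewrite (expr_eq_mod xn hk) -(@period_mod x (u * (2 * (c * e * k')))) //.
  rewrite -(expr_eq_mod xn (two_g0X _)) period_frobX quadratic_expr_pow2 //.
  by rewrite natrM (pcharf0 char2) mul0r addr0.
have -> : k = (2 ^ r.+1 * (e * k'))%N by rewrite kk' -subn1 ef; ring.
have -> : (u * (2 * (c * e * k')) = 2 ^ r.+1 * (u' * c * (e * k')))%N.
  by rewrite uu' expnS; ring.
have -> : (2 * delta = 2 ^ r.+1 * p ^ m.-1)%N by rewrite /delta expnS; ring.
by rewrite -!muln_modr -modnMml hc modnMml mul1n.
Qed.

(* Fourier inversion in z: T(x^(1 + pz)) is the sum over w in W of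
   x^w (x^p)^(wz), and the left-hand side is the coefficient of (x^p)^(cz). *)
Lemma sum_congruent_eq0 x c : x ^+ n = 1 ->
  (forall z, period (x ^+ (1 + p * z)) = period x) -> x ^+ p ^+ c != 1 ->
  \sum_(w | W w && (x ^+ p ^+ w == x ^+ p ^+ c)) x ^+ w = 0.
Proof.
move=> xn inv; set y := x ^+ p => yc1.
have yn : y ^+ n = 1 by rewrite /y -exprM mulnC exprM xn expr1n.
have y0 : y != 0.
  by apply: contra_eq_neq yn => ->; rewrite expr0n gtn_eqF ?(ltnW expn_prime_gt1) // eq_sym oner_eq0.
have n1R : n%:R = 1 :> K by rewrite natr_char2 expn_odd.
have ycn w : (y ^+ w / y ^+ c) ^+ n = 1.
  by rewrite expr_div_n -!exprM ![(_ * n)%N]mulnC !exprM yn !expr1n divr1.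
transitivity (\sum_(z : 'Z_n) period (x ^+ (1 + p * z)) / y ^+ c ^+ z).
  under [RHS]eq_bigr => z _ do rewrite /period mulr_suml.
  rewrite exchange_big /= big_mkcondr /=; apply: eq_bigr => w _.
  transitivity (x ^+ w * \sum_(z : 'Z_n) (y ^+ w / y ^+ c) ^+ z).
    have yc0 : y ^+ c != 0 by rewrite expf_neq0.
    rewrite sum_Zp_expr ?expn_prime_gt1 // n1R -(divff yc0) (inj_eq (mulIf (invr_neq0 yc0))).
    by rewrite divff //; case: ifP; rewrite ?mulr1 ?mulr0.
  rewrite mulr_sumr; apply: eq_bigr => z _.
  by rewrite expr_div_n mulrA -!exprM mulnDl mul1n exprD mulnAC mulnA.
under eq_bigr => z _ do rewrite inv -exprVn.
rewrite -mulr_sumr sum_Zp_expr ?expn_prime_gt1 //; last first.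
  by rewrite exprVn -exprM mulnC exprM yn expr1n invr1.
by rewrite invr_eq1 (negPf yc1) mulr0.
Qed.

Lemma expr_Zp_g0X (x : K) a : x ^+ n = 1 -> x ^+ (g0%:R ^+ a : 'Z_n) = x ^+ (g0 ^ a).
Proof. by move=> xn; rewrite -natrX val_Zp_nat ?expn_prime_gt1 // expr_mod. Qed.

(** * Roots of unity of order divisible by p^2 *)

Variable b0 : nat.
Hypothesis W_val : forall k, W (g0%:R ^+ (b0 + k)) = (k %% (2 * delta) < delta)%N.

(** The exponents congruent to g0^b0 modulo p^(k+1) are g0^b0 q^l for l < M, and x takes there the
    values theta zeta^l with zeta of order p. The window keeps the l with 2l < M, leaving a
    geometric sum. *)
Lemma window_sum_neq0 (x : K) e k : (p - 1 = e * 2 ^ r.+1)%N -> (k.+2 <= m)%N ->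
  x ^+ (p ^ k.+2) = 1 -> x ^+ (p ^ k.+1) != 1 ->
  \sum_(w | W w && (x ^+ p ^+ w == x ^+ p ^+ (g0 ^ b0))) x ^+ w != 0.
Proof.
move=> ef km xk xk1.
have p0 := prime_gt0 p_prime.
have xn : x ^+ n = 1 by rewrite /n -(subnKC km) expnD exprM xk expr1n.
have x1 : x != 1 by apply: contraNneq xk1 => ->; rewrite expr1n.
have prim_x := prime_pow_order p_prime xk xk1.
have prim_y : (p ^ k.+1).-primitive_root (x ^+ p).
  by apply: prime_pow_order; rewrite // -exprM -expnS.
set M := (p ^ (m.-1 - k))%N.
have mE : (p ^ m.-1 = p ^ k * M)%N.
  by rewrite -expnD subnKC // -ltnS prednK // ltnW.
have pM : (p %| M)%N by rewrite dvdn_exp // subn_gt0 -ltnS prednK.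
have M0 : (0 < M)%N by rewrite expn_gt0 p0.
have Modd : odd M by rewrite oddX p_odd orbT.
have [e' ee'] : exists e', (e * e' = 1 %[mod M])%N.
  apply: mod_inverse => //; apply: coprimeXr; rewrite coprime_sym prime_coprime //.
  apply/negP => pe; have : (p %| p - 1)%N by rewrite ef dvdn_mulr.
  by rewrite dvdn_subr ?dvdn1 ?gtn_eqF ?prime_gt1.
(* The inverse [e'] of [e] makes Q l congruent to 2^(r+1) p^k l modulo 2 delta, so that the window
   condition becomes 2l < M. *)
set Q := (p ^ k * p.-1 * e')%N.
have phi : totient n = (p ^ k * p.-1 * M)%N by rewrite totient_pfactor // mE; ring.
have Qmod a l : (Q * a == Q * l %[mod totient n])%N = (a == l %[mod M])%N.
  have Q0 : (0 < p ^ k * p.-1)%N by rewrite muln_gt0 expn_gt0 p0 -subn1 subn_gt0 prime_gt1.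
  have QE c : (Q * c = p ^ k * p.-1 * (e' * c))%N by rewrite mulnA.
  rewrite phi !QE -!muln_modr eqn_pmul2l //; apply/eqP/eqP => hal; last first.
    by rewrite -modnMmr hal modnMmr.
  have eK c : (c = e * (e' * c) %[mod M])%N by rewrite mulnA -modnMml ee' modnMml mul1n.
  by rewrite eK -modnMmr hal modnMmr -eK.
pose h (l : 'I_M) : 'Z_n := g0%:R ^+ (b0 + Q * l).
have h_inj : injective h.
  move=> l l' /eqP; rewrite (eq_prim_root_expr g0_prim) eqn_modDl Qmod.
  by rewrite !modn_small // => /eqP/val_inj.
pose q := (g0 ^ Q)%N.
have q1 : (q = 1 %[mod p ^ k.+1])%N.
  by apply/eqP; rewrite g0_exp_eq1 ?(ltnW km) //= /Q dvdn_mulr.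
have q2 : (q != 1 %[mod p ^ k.+2])%N.
  rewrite g0_exp_eq1 //= /Q expnSr -mulnA [(p * _)%N]mulnC mulnA dvdn_pmul2l; last first.
    by rewrite muln_gt0 expn_gt0 p0 -subn1 subn_gt0 prime_gt1.
  apply/negP => pe'; have : (p %| 1)%N.
    by rewrite /dvdn -(modn_dvdm _ pM) -ee' (modn_dvdm _ pM) -/(dvdn _ _) dvdn_mull.
  by rewrite dvdn1 gtn_eqF ?prime_gt1.
have yn : x ^+ p ^+ n = 1 by rewrite -exprM mulnC exprM xn expr1n.
have h_im (w : 'Z_n) : (x ^+ p ^+ w == x ^+ p ^+ (g0 ^ b0)) = (w \in h @: setT).
  apply/idP/imsetP => [|[l _ ->]]; last first.
    rewrite /h expr_Zp_g0X // (eq_prim_root_expr prim_y) expnD expnM -/q.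
    by apply/eqP; rewrite -modnMmr -modnXm q1 modnXm exp1n modnMmr muln1.
  rewrite (eq_prim_root_expr prim_y) => /eqP hw.
  have g0p : coprime p (g0 ^ b0).
    have := unitZpE (g0 ^ b0) expn_prime_gt1; rewrite natrX unitrX ?g0_unit // => /esym.
    by rewrite coprime_pexpl.
  have [a ha] : exists a, (w = g0 ^ (b0 + a) %[mod n])%N.
    apply: (primitive_root_generates_from _ expn_prime_gt1 g0_prim).
    rewrite coprime_pexpl // -(coprime_pexpl _ _ (ltn0Sn k)).
    by rewrite -coprime_modr hw coprime_modr coprime_pexpl.
  have pn : (p ^ k.+1 %| n)%N by rewrite dvdn_exp2l // ltnW.
  have : (g0 ^ a == 1 %[mod p ^ k.+1])%N.
    have : (g0 ^ b0 * g0 ^ a == g0 ^ b0 * 1 %[mod p ^ k.+1])%N.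
      by rewrite -expnD muln1 -hw -(modn_dvdm _ pn) -ha (modn_dvdm _ pn).
    by rewrite eqn_mod_pmul2l ?expn_gt0 ?p0 // coprime_pexpr // coprime_sym.
  rewrite g0_exp_eq1 ?(ltnW km) //= => /dvdnP[a' aa'].
  exists (Ordinal (ltn_pmod (e * a') M0)) => //.
  rewrite -[LHS]natr_Zp /h /= -natrX; apply/eqP; rewrite Zp_natP ?expn_prime_gt1 //.
  rewrite ha -!(@Zp_natP n) ?expn_prime_gt1 // !natrX (eq_prim_root_expr g0_prim) eqn_modDl.
  have -> : (Q * ((e * a') %% M) = Q * (e * a') %[mod totient n])%N.
    by apply/eqP; rewrite Qmod modn_mod.
  have -> : (Q * (e * a') = p ^ k * p.-1 * (e * e' * a'))%N by rewrite /Q; ring.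
  by rewrite aa' mulnC phi -!muln_modr -modnMml ee' modnMml mul1n.
pose theta := x ^+ (g0 ^ b0).
have prim_theta : (p ^ k.+2).-primitive_root theta.
  rewrite prim_root_exp_coprime // coprime_sym coprime_pexpl //.
  have := unitZpE (g0 ^ b0) expn_prime_gt1; rewrite natrX unitrX ?g0_unit // => /esym.
  by rewrite coprime_pexpl.
pose zeta := theta ^+ q / theta.
have theta0 : theta != 0.
  apply: contra_eq_neq (prim_expr_order prim_theta) => ->.
  by rewrite expr0n gtn_eqF ?expn_gt0 ?p0 // eq_sym oner_eq0.
have zeta1 : zeta != 1.
  rewrite /zeta -(divff theta0) (inj_eq (mulIf (invr_neq0 theta0))) -{2}[theta]expr1.
  by rewrite (eq_prim_root_expr prim_theta).
have zetap : zeta ^+ p = 1.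
  rewrite /zeta expr_div_n -exprM; suff -> : theta ^+ (q * p) = theta ^+ p.
    by rewrite divff // expf_neq0.
  apply/eqP; rewrite (eq_prim_root_expr prim_theta) expnS; apply/eqP.
  have : (p * q = p * 1 %[mod p * p ^ k.+1])%N by rewrite -!muln_modr q1.
  by rewrite muln1 mulnC.
have zetaq : zeta ^+ q = zeta.
  rewrite -[RHS]expr1; apply: (expr_eq_mod zetap).
  have pk : (p %| p ^ k.+1)%N by rewrite dvdn_exp.
  by rewrite -(modn_dvdm _ pk) q1 (modn_dvdm _ pk).
(* Raising to the power [q] multiplies theta by zeta and fixes zeta, as q = 1 modulo p. *)
have hx (l : 'I_M) : x ^+ (h l) = theta * zeta ^+ l.
  rewrite /h expr_Zp_g0X // expnD exprM -/theta; case: l => l /= _.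
  elim: l => [|l IH]; first by rewrite muln0 expn0 expr1 mulr1.
  rewrite mulnS addnC expnD exprM IH -/q exprMn [zeta ^+ l ^+ q]exprAC zetaq exprS.
  by rewrite mulrA; congr (_ * _); rewrite /zeta mulrC divfK.
have hW (l : 'I_M) : W (h l) = (2 * l < M)%N.
  rewrite /h W_val.
  have -> : (2 * delta = 2 ^ r.+1 * p ^ k * M)%N by rewrite /delta mE expnS; ring.
  have -> : (Q * l = 2 ^ r.+1 * p ^ k * (e * e' * l))%N by rewrite /Q -subn1 ef; ring.
  rewrite -muln_modr -modnMml ee' modnMml mul1n modn_small //.
  have -> : (delta = 2 ^ r * p ^ k * M)%N by rewrite /delta mE; ring.
  have -> : (2 ^ r.+1 * p ^ k * l = 2 ^ r * p ^ k * (2 * l))%N by rewrite expnS; ring.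
  by rewrite ltn_pmul2l // muln_gt0 !expn_gt0 p0.
rewrite (eq_bigl (fun w => W w && (w \in h @: setT))); last by move=> w; rewrite h_im.
under eq_bigl => w do rewrite andbC.
rewrite big_mkcondr big_imset; last by move=> ? ? _ _; exact: h_inj.
rewrite -big_mkcondr /=.
under eq_bigl => l do rewrite inE hW.
under eq_bigr => l _ do rewrite hx.
rewrite -mulr_sumr mulf_neq0 //.
have hM : (M = M./2.*2.+1)%N by rewrite -{1}[M]odd_double_half Modd.
have -> : \sum_(l < M | (2 * l < M)%N) zeta ^+ l = \sum_(l < M./2.+1) zeta ^+ l.
  rewrite (big_ord_widen M (fun l => zeta ^+ l)).
    by apply: eq_bigl => l; rewrite ltn_double_odd.
  by rewrite [X in (_ <= X)%N]hM ltnS -addnn leq_addr.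
(* A vanishing sum gives zeta^((M+1)/2) = 1; squaring, zeta^(M+1) = 1, while p divides M, so zeta =
   1. *)
apply: contra zeta1 => /eqP s0; have := subrX1 zeta M./2.+1.
rewrite s0 mulr0 => /eqP; rewrite subr_eq0 => /eqP z1.
have : zeta ^+ (M./2.+1 * 2) = zeta.
  have -> : (M./2.+1 * 2 = M + 1)%N by rewrite [in RHS]hM muln2 doubleS addn1.
  by rewrite exprD expr1; case/dvdnP: pM => c ->; rewrite mulnC exprM zetap expr1n mul1r.
by rewrite exprM z1 expr1n => <-.
Qed.

(** The order of x is p^a with a at least 2, so [1 < m] and the condition on [u] becomes available.
    Invariance of the period then makes the sum of [window_sum_neq0] vanish. *)
Lemma quadratic_high_order (x : K) e : (p - 1 = e * 2 ^ r.+1)%N ->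
  x ^+ n = 1 -> x ^+ p != 1 -> ((1 < m)%N -> ~~ (p %| u)%N) ->
  1 + period x + period x ^+ 2 != 0.
Proof.
move=> ef xn xp pu; apply/eqP => t2.
have x1 : x != 1 by apply: contraNneq xp => ->; rewrite expr1n.
have [d xd /(dvdn_pfactor _ _ p_prime)[a am dE]] := prim_order_exists (ltnW expn_prime_gt1) xn.
have a1 : (1 < a)%N.
  rewrite ltnNge; apply: contra xp => a1; rewrite -(prim_order_dvd xd) dE.
  by rewrite -{2}[p]expn1 dvdn_exp2l.
have {}dE : d = (p ^ (a - 2).+2)%N by rewrite dE -addn2 subnK.
have am' : ((a - 2).+2 <= m)%N by rewrite -addn2 subnK.
have xk : x ^+ (p ^ (a - 2).+2) = 1 by rewrite -dE prim_expr_order.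
have xk1 : x ^+ (p ^ (a - 2).+1) != 1.
  by rewrite -(prim_order_dvd xd) dE dvdn_Pexp2l ?prime_gt1 // ltnn.
have /eqP[] := window_sum_neq0 ef am' xk xk1.
apply: sum_congruent_eq0 => //.
  by move=> z; apply: (period_invariant z xn x1 t2 ef); apply: pu; apply: leq_trans am'.
by apply: expr_g0_neq1; rewrite // -exprM mulnC exprM xn expr1n.
Qed.

(** T(1) lies in F_2, where 1 + t + t^2 is always 1. *)
Lemma quadratic_1 : 1 + period 1 + period 1 ^+ 2 != 0.
Proof.
have [b ->] : exists b : bool, period 1 = b%:R.
  rewrite /period; under eq_bigr do rewrite expr1n.
  by rewrite sumr_const natr_char2; eexists.
by case: b; rewrite ?expr1n ?expr0n ?addr0 -?addrA ?addrr_char2 ?addr0 oner_eq0.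
Qed.

(** * Evaluating the generating polynomial *)

Variables (iota : {rmorphism 'F_2 -> K}) (s : nat -> 'F_2).
Hypothesis s_even :
  forall i, s (2 * i)%N = if (n %| i)%N then 1 else (W i%:R)%:R.
Hypothesis s_odd :
  forall i, odd i -> s i = if (n %| i)%N then 0 else (W i%:R)%:R.

Lemma sum_Zp_nat (F : nat -> K) : \sum_(z : 'Z_n) F z = \sum_(0 <= i < n) F i.
Proof. by rewrite -(big_mkord xpredT F) Zp_cast ?expn_prime_gt1. Qed.

Lemma sum_even_odd (F : nat -> K) k :
  \sum_(0 <= i < 2 * k) F i =
    \sum_(0 <= i < k) F (2 * i)%N + \sum_(0 <= i < k) F (2 * i).+1.
Proof.
elim: k => [|k IH]; first by rewrite !big_geq // addr0.
by rewrite mulnS !add2n !big_nat_recr //= IH -!addrA; congr (_ + _); rewrite addrCA.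
Qed.

(** The even positions contribute 1 + T(x^2), the 1 coming from position 0. The odd positions below
    2n meet each residue modulo n once and contribute T(x). *)
Lemma horner_sequence (x : K) : x ^+ n = 1 ->
  (map_poly iota (\poly_(i < 2 * n) s i)).[x] = 1 + period x + period x ^+ 2.
Proof.
move=> xn; rewrite -period_frob.
have W0 : W 0 = false by rewrite -(mulr0 (g0%:R ^+ delta)) W_shift eqxx.
rewrite (@horner_coef_wide _ (2 * n)); last first.
  by rewrite (leq_trans (size_poly _ _)) // size_poly.
under eq_bigr => i _ do rewrite coef_map coef_poly ltn_ord.
rewrite -(big_mkord xpredT (fun i => iota (s i) * x ^+ i)) sum_even_odd.
rewrite [1 + _]addrC -addrA addrC; congr (_ + _).
  rewrite -!sum_Zp_nat (bigD1 0) //= s_even dvdn0 rmorph1 mul1r expr0; congr (_ + _).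
  rewrite /period [RHS]big_mkcond [RHS](bigD1 0) //= W0 add0r; apply: eq_bigr => z z0.
  have nz : (n %| z)%N = false by rewrite /dvdn -val_Zp_nat ?expn_prime_gt1 // natr_Zp; exact: negPf.
  rewrite s_even nz natr_Zp rmorph_nat -exprM.
  by case: (W z); rewrite ?mul1r ?mul0r.
have two_unit : (2%:R : 'Z_n) \is a GRing.unit.
  by rewrite unitZpE ?expn_prime_gt1 // coprime_sym coprime2n expn_odd.
(* As n is odd, z -> 2z + 1 permutes Z/n. *)
have inj : injective (fun z : 'Z_n => 2%:R * z + 1).
  by move=> a b /addIr /(mulrI two_unit).
rewrite -sum_Zp_nat /period [RHS]big_mkcond [RHS](reindex_inj inj).
apply: eq_bigr => z _; cbv beta.
have zE : 2%:R * z + 1 = (2 * z).+1%:R by rewrite -[z in LHS]natr_Zp -natrM natr1.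
rewrite zE val_Zp_nat ?expn_prime_gt1 // expr_mod // s_odd; last by rewrite /= mul2n odd_double.
case: ifP => [dz|_]; last by rewrite rmorph_nat; case: (W _); rewrite ?mul1r ?mul0r.
have -> : (2 * z).+1%:R = 0 :> 'Z_n.
  by apply/eqP; rewrite -[0]/(0%:R) Zp_natP ?expn_prime_gt1 // mod0n.
by rewrite W0 rmorph0 mul0r.
Qed.
End GaussPeriods.

(** * From roots to the linear complexity *)

Lemma closed_separable_dvdp (K : closedFieldType) (p q : {poly K}) :
  separable_poly p -> (forall x, root p x -> root q x) -> p %| q.
Proof.
move=> sp pq; have [rs prs] := closed_field_poly_normal p.
have p0 : lead_coef p != 0 by rewrite lead_coef_eq0 separable_poly_neq0.
have prs' : p %= \prod_(z <- rs) ('X - z%:P) by rewrite {1}prs eqp_scale.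
rewrite (eqp_dvdl _ prs'); apply: uniq_roots_dvdp.
  apply/allP => x xrs; apply: pq; rewrite (eqp_root prs').
  by rewrite root_prod_XsubC.
rewrite uniq_rootsE -separable_prod_XsubC.
by rewrite -(eqp_separable prs').
Qed.

(** In characteristic 2, X^(2n) - 1 is (X^n - 1)^2. Without common roots the gcd is 1. If the common
    roots are exactly the elements of order p, the gcd lies between Phi and Phi^2, where Phi is the
    p-th cyclotomic polynomial, of degree p - 1. *)
Lemma LC_periodic_bounds (K : closedFieldType) (iota : {rmorphism 'F_2 -> K})
    (s : nat -> 'F_2) (p m : nat) :
  prime p -> odd p -> (0 < m)%N ->
  (forall j, s (j + 2 * p ^ m)%N = s j) ->
  let S := map_poly iota (\poly_(i < 2 * p ^ m) s i) in
  ((forall x, x ^+ (p ^ m) = 1 -> ~~ root S x) -> LC s = (2 * p ^ m)%N) /\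
  ((forall x, x ^+ (p ^ m) = 1 -> root S x = (x ^+ p == 1) && (x != 1)) ->
   (2 * p ^ m - 2 * (p - 1) <= LC s <= 2 * p ^ m - (p - 1))%N).
Proof.
move=> pp po m0 per S.
have char2 : 2 \in [pchar K] by apply: (rmorph_pchar iota); exact: pchar_Fp.
have p0 := prime_gt0 pp.
set n := (p ^ m)%N in per S *.
have n0 : (0 < n)%N by rewrite expn_gt0 p0.
have N0 : (0 < 2 * n)%N by rewrite muln_gt0.
pose G : {poly K} := gcdp ('X^(2 * n) - 1) S.
have sG : size (gcdp ('X^(2 * n) - 1) (\poly_(i < 2 * n) s i)) = size G.
  by rewrite -(size_map_poly iota) gcdp_map rmorphB /= map_polyXn rmorph1.
have PE : 'X^(2 * n) - 1 = ('X^n - 1) ^+ 2 :> {poly K}.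
  have char2P : 2 \in [pchar {poly K}] by rewrite (pchar_lalg {poly K}).
  rewrite -(pFrobenius_autE char2P) rmorphB rmorph1 /=.
  by rewrite pFrobenius_autE -exprM mulnC.
have G_S : G %| S by exact: dvdp_gcdr.
have LC_G : (size G <= 2 * n)%N -> LC s = (2 * n - (size G).-1)%N.
  by rewrite -sG; exact: LC_gcdp.
split=> [noroot|isroot].
  have cop : coprimep ('X^n - 1) S.
    apply: Pdiv.ClosedField.root_coprimep => x; rewrite /root !hornerE.
    rewrite subr_eq0 => /eqP/noroot; exact.
  have sG1 : size G = 1%N.
    by apply/eqP; rewrite -[_ == _]/(coprimep _ _) PE coprimep_expl.
  by rewrite LC_G sG1 ?subn0.
pose Phi : {poly K} := \sum_(i < p) 'X^i.
have pE : 'X^p - 1 = ('X - 1) * Phi by rewrite subrX1.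
pose Q : {poly K} := \sum_(i < p ^ m.-1) ('X^p) ^+ i.
have nE : 'X^n - 1 = ('X^p - 1) * Q.
  by rewrite -subrX1 -exprM -expnS prednK.
have natr_odd k : odd k -> k%:R = 1 :> K.
  by move=> ok; rewrite (natr_char2 char2) ok.
have sPhi : size Phi = p.
  have : size ('X^p - 1 : {poly K}) = p.+1 by rewrite size_XnsubC.
  have mX : ('X - 1 : {poly K}) \is monic by exact: monicXsubC.
  have Phi0 : Phi != 0.
    apply: contra_eq_neq pE => ->; rewrite mulr0 -size_poly_eq0 size_XnsubC //.
  by rewrite pE size_monicM // size_XsubC => -[].
have sep : separable_poly Phi.
  have : separable_poly ('X^p - 1 : {poly K}).
    by apply: separable_Xn_sub_1; rewrite natr_odd ?oner_eq0.
  by rewrite pE separable_mul => /and3P[].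
have rootPhi x : root Phi x -> (x ^+ p == 1) && (x != 1).
  move=> rx; have : root ('X^p - 1) x by rewrite pE rootM rx orbT.
  rewrite /root !hornerE subr_eq0 => -> /=.
  apply: contraL rx => /eqP->; rewrite /root horner_sum.
  under eq_bigr do rewrite hornerXn expr1n.
  by rewrite sumr_const card_ord natr_odd ?oner_eq0.
have xpn (x : K) : x ^+ p = 1 -> x ^+ n = 1.
  by move=> xp; rewrite /n -(prednK m0) expnS exprM xp expr1n.
have PhiG : Phi %| G.
  apply: closed_separable_dvdp => // x /rootPhi h; have /andP[/eqP xp x1] := h.
  have xn := xpn x xp.
  rewrite /G root_gcd isroot // h andbT /root !hornerE mulnC exprM xn expr1n.
  by rewrite subrr.
have GPhi : G %| Phi ^+ 2.
  have : G %| Phi ^+ 2 * (('X - 1) * Q) ^+ 2.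
    have -> : Phi ^+ 2 * (('X - 1) * Q) ^+ 2 = ('X^n - 1) ^+ 2.
      by rewrite nE pE -exprMn; congr (_ ^+ 2); ring.
    by rewrite -PE dvdp_gcdl.
  rewrite Gauss_dvdpl //; apply: coprimep_expr.
  rewrite coprimep_sym; apply: (coprimep_dvdl G_S).
  apply: Pdiv.ClosedField.root_coprimep => x.
  rewrite rootM => /orP[|rQ].
    rewrite root_XsubC => /eqP->; have := isroot 1 (expr1n _ _).
    by rewrite eqxx andbF /root => ->.
  have xn : x ^+ n = 1.
    have : root ('X^n - 1) x by rewrite nE rootM rQ orbT.
    by rewrite /root !hornerE subr_eq0 => /eqP.
  have := isroot x xn; rewrite /root => ->.
  (* A root of [Q] cannot satisfy x^p = 1, since [Q] would then take the value p^(m-1), which is 1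
     in K. *)
  rewrite negb_and; apply/orP; left; apply: contraL rQ => /eqP xp.
  rewrite /root horner_sum.
  under eq_bigr do rewrite -exprM hornerXn exprM xp expr1n.
  by rewrite sumr_const card_ord natr_odd ?oner_eq0 // oddX po orbT.
have Phi0 : Phi != 0 by rewrite separable_poly_neq0.
have sG_ge : (p <= size G)%N.
  by rewrite -{1}sPhi dvdp_leq // gcdp_eq0 negb_and -size_poly_eq0 size_XnsubC.
have sG_le : (size G <= (p.-1 * 2).+1)%N.
  rewrite (leq_trans (dvdp_leq _ GPhi)) ?expf_neq0 //.
  by rewrite (leq_trans (size_poly_exp_leq _ _)) // sPhi.
have pn : (p <= n)%N by rewrite dvdn_leq // dvdn_exp.
have p1 := prime_gt1 pp.
have ge2 : (size G <= 2 * n)%N.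
  apply: leq_trans sG_le _; apply: (@leq_trans (2 * p)); last by rewrite leq_mul2l.
  by move: p1; clear; case: p => //= k _; lia.
rewrite LC_G //; move: (size G) (n) sG_ge sG_le pn p1 => a c; clear.
case: p => // k; rewrite subn1 /=; lia.
Qed.

(** * Integer congruences and the final assembly *)

Lemma modz_exp2_eq (e d : nat) :
  ((2 : int) ^+ e = 1 %[mod d])%Z <-> (d %| 2 ^ e - 1)%N.
Proof.
have -> : ((2 : int) ^+ e = (2 ^ e)%N%:Z) by rewrite -natrX natz.
split=> [/eqP|h]; last apply/eqP; rewrite eqz_mod_dvd -[1]/(1%N%:Z) subzn ?expn_gt0 //.
Qed.

Lemma modz_exp2_eqN1 (e d : nat) :
  ((2 : int) ^+ e = -1 %[mod d])%Z <-> (d %| 2 ^ e + 1)%N.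
Proof.
have -> : ((2 : int) ^+ e = (2 ^ e)%N%:Z) by rewrite -natrX natz.
by split=> [/eqP|h]; last apply/eqP; rewrite eqz_mod_dvd opprK -PoszD.
Qed.

Unset Implicit Arguments.

Theorem theorem1 (p m e f r : nat) (b g : int) (s : nat -> 'F_2)
  (p_prime : prime p) (p_odd : odd p) (m_ge1 : (1 <= m)%N)
  (r_ge1 : (1 <= r)%N) (f_def : f = (2 ^ r)%N) (ef_def : (p - 1)%N = (e * f)%N)
  (g_odd : ~~ (2 %| g)%Z) (g_prim : primitive_root_mod (p ^ m) g)
  (s_C1 : forall i : nat, (i%:R : 'Z_(2 * p ^ m)) \in cyc_C1 p m e g b -> s i = 1)
  (s_C0 : forall i : nat, (i%:R : 'Z_(2 * p ^ m)) \in cyc_C0 p m e g b -> s i = 0) :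
  ((~ ((2 : int) ^+ e = 1 %[mod p])%Z /\ ~ ((2 : int) ^+ e = -1 %[mod p])%Z)
     \/ (((2 : int) ^+ e = 1 %[mod p])%Z /\ ~ ((2 : int) ^+ e = 1 %[mod p%:Z ^+ 2])%Z) ->
   LC s = (2 * p ^ m)%N)
  /\
  (((2 : int) ^+ e = -1 %[mod p])%Z /\ ~ ((2 : int) ^+ e = -1 %[mod p%:Z ^+ 2])%Z ->
   (2 * p ^ m - 2 * (p - 1) <= LC s <= 2 * p ^ m - (p - 1))%N).
Proof.
(* From here f/2 = 2^r', matching the [r] of the preceding lemmas. *)
case: r r_ge1 f_def => // r' _ f_def; rewrite {}f_def {f} in ef_def.
have [g0 [b0 [W [prim W_shift W_val s_even s_odd]]]] :=
  exists_window p_prime p_odd m_ge1 ef_def g_odd g_prim s_C1 s_C0.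
have [K [iota _]] := countable_algebraic_closure 'F_2.
have char2 : 2 \in [pchar K] by apply: (rmorph_pchar iota); exact: pchar_Fp.
set n := (p ^ m)%N in W W_shift W_val s_even s_odd prim *.
have n1 : (1 < n)%N by exact: expn_prime_gt1.
have [u hu] : exists u, (2 = g0 ^ u %[mod n])%N.
  apply: (primitive_root_generates n1 prim).
  by rewrite coprime_sym coprime2n expn_odd.
have per j : s (j + 2 * n)%N = s j.
  have nR : n%:R = 0 :> 'Z_n by rewrite pchar_Zp.
  have [oj|/negPf ej] := boolP (odd j).
    have oj2 : odd (j + 2 * n) by rewrite oddD oj oddM.
    by rewrite !s_odd // dvdn_addl ?dvdn_mull // natrD natrM nR mulr0 addr0.
  rewrite -[j]odd_double_half ej add0n -mul2n -mulnDr !s_even.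
  by rewrite dvdn_addl // natrD nR addr0.
have [LC_noroot LC_root] := LC_periodic_bounds iota p_prime p_odd m_ge1 per.
pose S : {poly K} := map_poly iota (\poly_(i < 2 * n) s i).
have SE x : x ^+ n = 1 -> root S x = (1 + period W x + period W x ^+ 2 == 0).
  by move=> xn; rewrite /root (horner_sequence p_prime p_odd m_ge1 char2 W_shift).
have S1 : root S 1 = false.
  by rewrite SE ?expr1n //; apply: negbTE; exact: (quadratic_1 char2).
have Sindex x : x ^+ n = 1 -> root S x -> (2 ^ r' %| u)%N && ~~ (2 ^ r'.+1 %| u)%N.
  move=> xn; have [->|x1] := eqVneq x 1; first by rewrite S1.
  rewrite SE // => /eqP.
  exact: (quadratic_index p_prime p_odd m_ge1 prim hu char2 W_shift).
have one := two_exp_eq1 p_prime m_ge1 prim hu 1 ef_def.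
rewrite !muln1 eqn_mod_dvd ?expn_gt0 // in one.
(* In (1), a root would make 2^r' the exact power of 2 in [u]: the first alternative contradicts 2^e
   = 1 or -1 modulo p, the second gives 2^(r'+1) dividing [u]. *)
split=> [hyp|].
  apply: LC_noroot => x xn; apply/negP => /(Sindex x xn)/andP[ru nru].
  case: hyp => [[h1 h2]|[/modz_exp2_eq h1 _]]; last by rewrite -one h1 in nru.
  have := two_index_sqr1 p_prime m_ge1 prim hu ef_def ru.
  by case/orP => [/modz_exp2_eq|/modz_exp2_eqN1].
(* In (2), x = 1 is no root, elements of order p are roots, and higher orders are excluded because p
   does not divide [u] when 1 < m. *)
case=> /modz_exp2_eqN1 h1 h2; apply: LC_root => x xn.
have rr := two_index_opp1 p_prime p_odd m_ge1 prim hu ef_def h1.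
have pu : (1 < m)%N -> ~~ (p %| u)%N.
  move=> m1; apply: (two_index_prime p_prime p_odd m_ge1 prim hu m1 ef_def h1).
  have p2 : p%:Z ^+ 2 = (p ^ 2)%N by rewrite -[RHS]natz natrX natz.
  by apply/negP => /modz_exp2_eqN1; rewrite -p2.
have [->|x1] := eqVneq x 1; first by rewrite S1 andbF.
rewrite andbT -/S SE //; case: (eqVneq (x ^+ p) 1) => [xp|xp].
  by apply/eqP; exact: (quadratic_order_p p_prime m_ge1 prim hu char2 W_shift).
apply: negbTE.
exact: (quadratic_high_order p_prime p_odd m_ge1 prim hu char2 W_shift W_val ef_def).
Qed.
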